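(* There exist constants $c,C>0$ and $N_0$ such that for every $N=2^n\ge N_0$, every positive integer $K\le N^{1/3}$, and every set $S$ of $N$ distinct Boolean functions $f:\{0,1\}^n\to\{0,1\}$ whose $N\times N$ matrix belongs to $B(K)$ (i.e. every row and every column of the matrix has exactly $K$ $1$'s), the bounded-error quantum query complexity $Q(S)$ of identifying the input oracle from $S$ satisfies $$c\sqrt{N/K}\le Q(S)\le C\sqrt{N/K}.$$
   Context: Let $N=2^n$. An oracle is a Boolean function $f:\{0,1\}^n\to\{0,1\}$, and inputs are identified with integers $0,\dots,N-1$ via binary representation. A set $S=\{f_0,\dots,f_{N-1}\}$ of $N$ distinct oracles is viewed as an $N\times N$ Boolean matrix whose entry in row $i$, column $j$ is $f_i(j)$. The oracle identification problem (OIP) for $S$: the set $S$ is completely known, an unknown $f\in S$ (the input oracle) is given as a black box, and the task is to determine which element of $S$ it is. A quantum algorithm with $t$ queries is a sequence $U_0,O_f,U_1,O_f,\dots,O_f,U_t$ applied to a fixed initial state (with arbitrary finite workspace), followed by a measurement producing the output, where the $U_j$ are arbitrary unitaries independent of $f$ and $O_f$ maps $|x\rangle|b\rangle$ to $(-1)^{b\cdot f(x)}|x\rangle|b\rangle$ for $x\in\{0,1\}^n$, $b\in\{0,1\}$ (identity on the rest of the workspace). It solves the OIP for $S$ with bounded error if for every $f\in S$, when run with $O_f$, it outputs (the index of) $f$ with probability at least $2/3$. $Q(S)$ is the minimum $t$ for which such an algorithm exists. *)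

(* Defs.v *)
From mathcomp Require Import all_boot all_order all_algebra.
From mathcomp Require Export spectral sesquilinear complex.
From mathcomp Require Export mathcomp_extra boolp classical_sets reals exp.

Set Implicit Arguments.
Unset Strict Implicit.
Unset Printing Implicit Defensive.

Import Order.TTheory GRing.Theory Num.Theory.
Local Open Scope ring_scope.
Local Open Scope complex_scope.
Local Open Scope sesquilinear_scope.

Notation bits n := (n.-tuple bool).
Notation oracle n := {ffun bits n -> bool}.

(* Most significant bit first. *)
Definition binary (n : nat) (j : nat) : bits n :=
  [tuple odd (j %/ 2 ^ (n.-1 - i)) | i < n].

(* A set of 2^n distinct oracles is given by an injective enumeration
   f_0, ..., f_(2^n - 1). *)
Definition oracle_matrix (n : nat) (f : 'I_(2 ^ n) -> oracle n) :
    'M[bool]_(2 ^ n) :=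
  \matrix_(i, j) f i (binary n j).

Definition B (m K : nat) : {set 'M[bool]_m} :=
  [set A : 'M[bool]_m | [forall i, #|[set j | A i j]| == K]
                     && [forall j, #|[set i | A i j]| == K]].

(* Basis states |x>|b>|w>, where w ranges over a d-element workspace basis. *)
Notation basis n d := (bits n * bool * 'I_d)%type.
Notation qdim n d := #|{: basis n d}|.

Definition oracle_phase (n d : nat) (g : oracle n) (s : basis n d) : bool :=
  let: (x, b, _) := s in b && g x.

Definition oracle_op (R : realType) (n d : nat) (g : oracle n) :
    'M[R[i]]_(qdim n d) :=
  diag_mx (\row_k (-1) ^+ oracle_phase g (enum_val k)).

(* States are column vectors.  The measurement is an arbitrary generalized
   measurement with outcomes in 'I_(2^n): operators M_y such that
   sum_y M_y^* M_y = 1, outcome y on state v having probability |M_y v|^2. *)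
Record algorithm (R : realType) (n t : nat) := Algorithm {
  wdim : nat;
  init : 'cV[R[i]]_(qdim n wdim);
  unitary_op : 'I_t.+1 -> 'M[R[i]]_(qdim n wdim);
  measure_op : 'I_(2 ^ n) -> 'M[R[i]]_(qdim n wdim);
  init_unit : \sum_k `|init k ord0| ^+ 2 = 1;
  unitary_opP : forall j, unitary_op j \is unitarymx;
  measure_opP : \sum_y (measure_op y)^t* *m measure_op y = 1%:M
}.

(* The state U_j O_g U_(j-1) ... O_g U_0 |init>, meaningful for j <= t. *)
Fixpoint run_upto (R : realType) (n t : nat) (A : algorithm R n t)
    (g : oracle n) (j : nat) : 'cV[R[i]]_(qdim n (wdim A)) :=
  if j is j'.+1
  then unitary_op A (inord j) *m
         (oracle_op R (wdim A) g *m run_upto A g j')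
  else unitary_op A ord0 *m init A.

Definition final_state (R : realType) (n t : nat) (A : algorithm R n t)
    (g : oracle n) := run_upto A g t.

Definition prob_output (R : realType) (n t : nat) (A : algorithm R n t)
    (g : oracle n) (y : 'I_(2 ^ n)) : R[i] :=
  \sum_k `|(measure_op A y *m final_state A g) k ord0| ^+ 2.

Definition solves_OIP (R : realType) (n t : nat) (A : algorithm R n t)
    (f : 'I_(2 ^ n) -> oracle n) : Prop :=
  forall i, 2%:R / 3%:R <= prob_output A (f i) i.

Definition solvable_with (R : realType) (n : nat)
    (f : 'I_(2 ^ n) -> oracle n) (t : nat) : Prop :=
  exists A : algorithm R n t, solves_OIP A f.

(* The least t for which a t-query bounded-error algorithm exists (the
   default value 0 is used only if there is no such t). *)
Definition Q (R : realType) (n : nat) (f : 'I_(2 ^ n) -> oracle n) : nat :=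
  xget 0%N (fun t => solvable_with R f t /\
                     forall t', solvable_with R f t' -> (t <= t')%N).

(* Main.v *)
From mathcomp Require Import all_boot all_order all_algebra.
From mathcomp Require Import perm.
From mathcomp Require Import reals exp trigo derive topology normedtype.
From mathcomp Require Import ring lra zify.
Require Import Defs.

(* Lower bound (hybrid argument): run the algorithm on the zero oracle.  Every
   column has K ones, so the total weight that its t queries put on the ones of
   f_i, summed over all i, is at most t K; hence the final states for the f_i
   lie, in sum of squares, within 4 t^2 K of a single state, which cannot favour
   more than a bounded number of outcomes.  This forces N = O(t^2 K).

   Upper bound: the input oracle f has K ones, so Grover search finds x with
   f x = 1 using O(sqrt (N / K)) queries.  Only K candidates take the value 1
   at x, and K probes depending on x tell them apart.  Since K^3 <= N, these
   K probes cost at most sqrt (N / K) further queries. *)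

Set Implicit Arguments.
Unset Strict Implicit.
Unset Printing Implicit Defensive.

Import Order.TTheory GRing.Theory Num.Theory.
Import numFieldNormedType.Exports.
Local Open Scope ring_scope.

(** * Lower bound *)

Lemma sum_linear_combination (C : pzRingType) (I : finType) (a b : C) F G :
  \sum_(i : I) (a * F i + b * G i) = a * (\sum_i F i) + b * (\sum_i G i).
Proof. by rewrite big_split !mulr_sumr. Qed.

Section SquaredNorm.
Local Open Scope sesquilinear_scope.
Variable C : numClosedFieldType.

Definition sqnorm n (v : 'cV[C]_n) : C := \sum_k `|v k ord0| ^+ 2.

Lemma sqnormE n (v : 'cV[C]_n) : sqnorm v = (v^t* *m v) ord0 ord0.
Proof. by rewrite mxE; apply: eq_bigr => k _; rewrite !mxE mulrC normCK. Qed.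

Lemma sqnorm_ge0 n (v : 'cV[C]_n) : 0 <= sqnorm v.
Proof. by apply: sumr_ge0 => k _; rewrite exprn_ge0. Qed.

Lemma sqnorm_unitary n (U : 'M[C]_n) (v : 'cV[C]_n) :
  U \is unitarymx -> sqnorm (U *m v) = sqnorm v.
Proof.
move=> /unitarymxP UU; rewrite !sqnormE trmx_mul map_mxM -mulmxA.
by rewrite (mulmxA _ U) (mulmx1C UU) mul1mx.
Qed.

Lemma sum_sqnorm_measure (I : finType) n (M : I -> 'M[C]_n) (v : 'cV[C]_n) :
  \sum_y (M y)^t* *m M y = 1%:M -> \sum_y sqnorm (M y *m v) = sqnorm v.
Proof.
move=> M1; under eq_bigr => y _ do
  rewrite sqnormE trmx_mul map_mxM -mulmxA (mulmxA _ (M y)).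
by rewrite -summxE -mulmx_sumr -mulmx_suml M1 mul1mx sqnormE.
Qed.

(* [j (j+1) (|a|^2/j + |b|^2) - j |a + b|^2 = |a - j b|^2] *)
Lemma sqnormD_weighted n (u v : 'cV[C]_n) (j : nat) :
  j%:R * sqnorm (u + v) <=
  j.+1%:R * sqnorm u + (j * j.+1)%:R * sqnorm v.
Proof.
rewrite !mulr_sumr -big_split /=; apply: ler_sum => k _; rewrite !mxE.
move: (u k ord0) (v k ord0) => a b; rewrite -subr_ge0.
have : 0 <= `|a - j%:R * b| ^+ 2 by rewrite exprn_ge0.
rewrite !normCK !rmorphD !rmorphN !rmorphM /= conjC_nat => /le_trans; apply.
by rewrite -natr1 le_eqVlt; apply/orP; left; apply/eqP; ring.
Qed.

Lemma sqnormD n (u v : 'cV[C]_n) :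
  sqnorm (u + v) <= 2%:R * sqnorm u + 2%:R * sqnorm v.
Proof. by have := sqnormD_weighted u v 1; rewrite mul1r. Qed.

End SquaredNorm.

Section Oracle.
Local Open Scope complex_scope.
Variables (R : realType) (n d : nat).

Lemma oracle_opE (g : oracle n) (v : 'cV[R[i]]_(qdim n d)) k :
  (oracle_op R d g *m v) k ord0 =
  (-1) ^+ oracle_phase g (enum_val k) * v k ord0.
Proof. by rewrite mul_diag_mx !mxE. Qed.

Lemma sqnorm_oracle_op (g : oracle n) (v : 'cV[R[i]]_(qdim n d)) :
  sqnorm (oracle_op R d g *m v) = sqnorm v.
Proof.
apply: eq_bigr => k _; rewrite oracle_opE normrM normrX normrN1 expr1n.
by rewrite mul1r.
Qed.

(** The two phases disagree only on queried ones of [g], where they are -1 and 1; the factor 4 is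
    the square of this gap. *)
Lemma sqnorm_oracle_opB (g : oracle n) (v : 'cV[R[i]]_(qdim n d)) :
  sqnorm (oracle_op R d g *m v - oracle_op R d [ffun=> false] *m v) =
  \sum_k 4%:R * (oracle_phase g (enum_val k))%:R * `|v k ord0| ^+ 2.
Proof.
apply: eq_bigr => k _; rewrite [in LHS]mxE [X in _ + X]mxE !oracle_opE.
case: (enum_val k) => -[x b] w /=; rewrite ffunE andbF expr0 mul1r.
case: (b && g x); last by rewrite mul1r subrr normr0 expr0n /= mulr0 mul0r.
rewrite expr1 mulN1r mulr1 -opprD normrN -mulr2n normrMn.
by rewrite -[X in X ^+ 2]mulr_natl exprMn -natrX.
Qed.

End Oracle.

Section LowerBound.
Local Open Scope complex_scope.
Variables (R : realType) (n K t : nat) (f : 'I_(2 ^ n) -> oracle n).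
Hypothesis colK : forall x, (#|[set i | f i x]| <= K)%N.
Variable A : algorithm R n t.

Let g0 : oracle n := [ffun=> false].

Lemma sqnorm_run g j : sqnorm (run_upto A g j) = 1.
Proof.
elim: j => [|j IH] /=.
  by rewrite sqnorm_unitary ?unitary_opP //; exact: init_unit.
by rewrite sqnorm_unitary ?unitary_opP // sqnorm_oracle_op.
Qed.

(** Double counting: a basis state querying [x] contributes only for those [i] with [f i x], at most
    [K] of them. *)
Lemma sum_query_weight (v : 'cV[R[i]]_(qdim n (wdim A))) :
  sqnorm v = 1 ->
  \sum_i sqnorm (oracle_op R _ (f i) *m v - oracle_op R _ g0 *m v)
  <= (4 * K)%:R.
Proof.
move=> v1; under eq_bigr => i _ do rewrite sqnorm_oracle_opB.
rewrite exchange_big /=.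
apply: (@le_trans _ _ (\sum_k (4 * K)%:R * `|v k ord0| ^+ 2)); last first.
  by rewrite -mulr_sumr -/(sqnorm v) v1 mulr1.
apply: ler_sum => k _; rewrite -mulr_suml -mulr_sumr -natr_sum -natrM.
apply: ler_wpM2r; first by rewrite exprn_ge0.
rewrite ler_nat leq_mul2l /=; case: (enum_val k) => -[x b] w /=.
apply: leq_trans (colK x); rewrite -sum1_card [leqRHS]big_mkcond /=.
by apply: leq_sum => i _; rewrite inE; case: b; case: (f i x).
Qed.

(** The weight [j] in [sqnormD_weighted] makes the recursion close exactly: (j+1) 4K j^2 + j (j+1)
    4K = j 4K (j+1)^2. *)
Lemma sum_run_distance j :
  \sum_i sqnorm (run_upto A (f i) j - run_upto A g0 j)
  <= (4 * K * j ^ 2)%:R.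
Proof.
elim: j => [|j IH].
  rewrite big1 ?muln0 // => i _; rewrite subrr /sqnorm big1 // => k _.
  by rewrite mxE normr0 expr0n.
set ph := run_upto A g0 j in IH *.
(* Hybrid step: the distance accumulated so far, plus the error of one new query made on the
   reference state [ph]. *)
have split i : run_upto A (f i) j.+1 - run_upto A g0 j.+1 =
    unitary_op A (inord j.+1) *m
     (oracle_op R _ (f i) *m (run_upto A (f i) j - ph) +
      (oracle_op R _ (f i) *m ph - oracle_op R _ g0 *m ph)).
  by rewrite /= -mulmxBr; congr (_ *m _); rewrite mulmxBr addrA subrK.
under eq_bigr => i _ do rewrite split sqnorm_unitary ?unitary_opP //.
have wK := sum_query_weight (sqnorm_run g0 j); rewrite -/ph in wK.
(* The weighted inequality is empty at [j = 0], but there the two runs still coincide. *)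
have [j0|j_gt0] := posnP j.
  subst j; rewrite exp1n muln1; apply: le_trans wK; apply: ler_sum => i _.
  by rewrite subrr mulmx0 add0r.
rewrite -(ler_pM2l (_ : 0 < j%:R)) ?ltr0n // mulr_sumr.
apply: le_trans (_ : _ <= \sum_i
   (j.+1%:R * sqnorm (run_upto A (f i) j - ph) + (j * j.+1)%:R *
     sqnorm (oracle_op R _ (f i) *m ph - oracle_op R _ g0 *m ph))) _.
  apply: ler_sum => i _; apply: le_trans (sqnormD_weighted _ _ _) _.
  by rewrite sqnorm_oracle_op.
rewrite sum_linear_combination.
apply: le_trans (lerD (ler_wpM2l _ IH) (ler_wpM2l _ wK)) _; rewrite ?ler0n //.
by rewrite -!natrM -natrD ler_nat; apply: eq_leq; ring.
Qed.

(** On the single reference state the outcome probabilities p_i sum to 1, so summing 2/3 <= 2 p_i +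
    2 d_i over [i], with d_i the squared distances, gives 2N/3 <= 2 + 8 K t^2. *)
Lemma solves_OIP_lower : solves_OIP A f -> (2 ^ n <= 3 + 12 * K * t ^ 2)%N.
Proof.
move=> sol; pose M := measure_op A; pose v i := final_state A (f i).
have out i : 2%:R / 3%:R <=
    2%:R * sqnorm (M i *m run_upto A g0 t) + 2%:R * sqnorm (v i - run_upto A g0 t).
  apply: (le_trans (sol i)).
  have -> : prob_output A (f i) i = sqnorm (M i *m v i) by [].
  rewrite -{1}[v i](subrK (run_upto A g0 t)) addrC mulmxDr.
  apply: le_trans (sqnormD _ _) _; rewrite lerD2l ler_wpM2l ?ler0n //.
  rewrite -[leRHS](sum_sqnorm_measure _ (measure_opP A)) (bigD1 i) //= lerDl.
  by apply: sumr_ge0 => y _; exact: sqnorm_ge0.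
have : \sum_(i < 2 ^ n) (2%:R / 3%:R : R[i]) <=
    2%:R * 1 + 2%:R * (4 * K * t ^ 2)%:R.
  apply: le_trans (ler_sum _ (fun i _ => out i)) _.
  rewrite sum_linear_combination lerD ?ler_wpM2l ?ler0n //.
    by rewrite (sum_sqnorm_measure _ (measure_opP A)) sqnorm_run.
  exact: sum_run_distance.
rewrite sumr_const card_ord -(ler_pM2l (_ : 0 < 3%:R)) ?ltr0n //.
rewrite [X in X <= _](_ : _ = (2 * 2 ^ n)%:R); last first.
  by rewrite -[in LHS]mulr_natr natrM; field.
rewrite mulr1 -natrM -natrD -natrM ler_nat; lia.
Qed.

End LowerBound.

(** * Circuits acting on labels *)

Definition orthogonal_kernel (R : pzRingType) (L : finType) (V : L -> L -> R) :=
  forall a b, \sum_l V a l * V b l = (a == b)%:R.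

Lemma sum_indicator (R : pzRingType) (I : finType) (F : I -> R) i0 :
  \sum_i (i == i0)%:R * F i = F i0.
Proof.
rewrite (bigD1 i0) //= eqxx mul1r big1 ?addr0 // => i /negPf ->.
by rewrite mul0r.
Qed.

Section LabelModel.
Local Open Scope complex_scope.
Local Open Scope sesquilinear_scope.
Variables (R : realType) (n t : nat) (L : finType).
Variables (query : nat -> L -> bits n * bool) (V : nat -> L -> L -> R).
Variables (phi0 : L -> R) (out : L -> 'I_(2 ^ n)).
Hypothesis orthV : forall j, orthogonal_kernel (V j).
Hypothesis phi0_unit : \sum_l phi0 l ^+ 2 = 1.

Definition query_phase (g : oracle n) (z : bits n * bool) : bool := z.2 && g z.1.

(** An abstract circuit with real amplitudes on labels alone, whose query is a function of round and
    label. The section realises it as an [algorithm]. *)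
Fixpoint label_state (g : oracle n) (j : nat) : L -> R :=
  if j is j'.+1 then fun l => \sum_l' V j l l' *
       ((-1) ^+ query_phase g (query j' l') * label_state g j' l')
  else fun l => \sum_l' V 0 l l' * phi0 l'.

Local Notation d := #|L|.
Local Notation S := (basis n d).

Let z0 : bits n * bool := ([tuple false | _ < n], false).
Let label (s : S) : L := enum_val s.2.

(* In round [j] the label [l] is carried by the basis state
   [(slot j l)^-1 z0], whose oracle registers read [query (j - 1) l]. *)
Let slot (j : nat) (l : L) : {perm bits n * bool} :=
  if j is j'.+1 then tperm z0 (query j' l) else 1%g.

(** Resetting the registers with the old slot before loading them with the new one lets labels with
    different queries interfere. *)
Let kernel (j : nat) (s s' : S) : R :=
  V j (label s) (label s') *
  (slot j (label s') s'.1 == slot j.+1 (label s) s.1)%:R.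

Lemma sum_index (M : nmodType) (G : bits n * bool -> L -> M) :
  \sum_(k < qdim n d) G (enum_val k).1 (label (enum_val k)) =
  \sum_l \sum_z G z l.
Proof.
rewrite -(big_enum_val (fun s : S => G s.1 (label s))) /= exchange_big.
rewrite [RHS](eq_bigr (fun z => \sum_(w < d) G z (enum_val w))).
  by rewrite pair_bigA.
by move=> z _; rewrite -big_enum_val.
Qed.

Lemma label_inj (s s' : S) : s.1 = s'.1 -> label s = label s' -> s = s'.
Proof. by case: s s' => [z w] [z' w'] /= -> /enum_val_inj /= ->. Qed.

(** For each label [l], [slot j l] permutes the register values; after reindexing by it the
    indicator leaves one term. *)
Lemma sum_kernel j (s : S) (F : bits n * bool -> L -> R) :
  \sum_(k < qdim n d) kernel j s (enum_val k) *
     F (slot j (label (enum_val k)) (enum_val k).1) (label (enum_val k)) =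
  \sum_l V j (label s) l * F (slot j.+1 (label s) s.1) l.
Proof.
rewrite (sum_index (fun z l => V j (label s) l *
  (slot j l z == slot j.+1 (label s) s.1)%:R * F (slot j l z) l)).
apply: eq_bigr => l _.
rewrite -(sum_indicator (fun z => V j (label s) l * F z l)).
rewrite [RHS](reindex_inj (@perm_inj _ (slot j l))) /=.
by apply: eq_bigr => z _; ring.
Qed.

Let circuit_unitary (j : nat) : 'M[R[i]]_(qdim n d) :=
  \matrix_(a, b) (kernel j (enum_val a) (enum_val b))%:C.

(** By [sum_kernel], the product of two rows is a row product of [V j] times an equality of slotted
    registers; once the labels agree, the slot cancels as a permutation. *)
Lemma circuit_unitaryP j : circuit_unitary j \is unitarymx.
Proof.
apply/unitarymxP/matrixP => a b; rewrite !mxE.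
set s := enum_val a; set s' := enum_val b.
under eq_bigr => k _ do rewrite !mxE conj_Creal -/s -/s' ?complex_real //= -rmorphM.
rewrite -rmorph_sum /= (sum_kernel j s (fun z l => V j (label s') l *
  (z == slot j.+1 (label s') s'.1)%:R)).
under eq_bigr => l _ do rewrite mulrA.
rewrite -mulr_suml orthV -natrM mulnb.
rewrite (_ : _ && _ = (a == b)) ?rmorph_nat // /s /s'.
apply/andP/eqP => [[/eqP ll /eqP]|->//].
by rewrite ll => /perm_inj zz; apply: enum_val_inj; apply: label_inj.
Qed.

Let vector (z : L -> bits n * bool -> bool) (phi : L -> R) : 'cV[R[i]]_(qdim n d) :=
  \col_k ((z (label (enum_val k)) (enum_val k).1)%:R *
          phi (label (enum_val k)))%:C.

Lemma circuit_unitary_vector j phi :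
  circuit_unitary j *m vector (fun l z => slot j l z == z0) phi =
  vector (fun l z => slot j.+1 l z == z0) (fun l => \sum_l' V j l l' * phi l').
Proof.
apply/matrixP => a b; rewrite !mxE; set s := enum_val a.
under eq_bigr => k _ do rewrite !mxE -rmorphM.
rewrite -rmorph_sum /=; congr (_%:C).
rewrite (sum_kernel j s (fun z l => (z == z0)%:R * phi l)) mulr_sumr.
by apply: eq_bigr => l _; ring.
Qed.

(** Slot [j.+1] belongs to [query j]: its transposition sends only [query j l] to [z0], so the
    registers hold exactly that query. *)
Lemma oracle_op_vector (g : oracle n) j phi :
  oracle_op R d g *m vector (fun l z => slot j.+1 l z == z0) phi =
  vector (fun l z => slot j.+1 l z == z0)
    (fun l => (-1) ^+ query_phase g (query j l) * phi l).
Proof.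
apply/matrixP => k c; rewrite mul_diag_mx !mxE /=.
have -> : oracle_phase g (enum_val k) = query_phase g (enum_val k).1.
  by case: (enum_val k) => -[x b] w.
case: eqP => [Ez|_]; last by rewrite !mul0r mulr0.
rewrite (_ : (enum_val k).1 = query j (label (enum_val k))).
  by rewrite !mul1r rmorphM rmorph_sign.
by apply: (@perm_inj _ (tperm z0 (query j (label (enum_val k))))); rewrite Ez tpermR.
Qed.

Let circuit_measure (y : 'I_(2 ^ n)) : 'M[R[i]]_(qdim n d) :=
  diag_mx (\row_k (out (label (enum_val k)) == y)%:R).

Lemma circuit_measureP :
  \sum_y (circuit_measure y)^t* *m circuit_measure y = 1%:M.
Proof.
apply/matrixP => a b; rewrite summxE.
rewrite (eq_bigr (fun y => (y == out (label (enum_val a)))%:R * (a == b)%:R)).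
  by rewrite sum_indicator mxE.
move=> y _; rewrite tr_diag_mx map_diag_mx mul_diag_mx !mxE rmorph_nat eq_sym.
by case: (y == _); case: (a == b); rewrite ?(mulr0, mulr1, mul0r, mulr0n).
Qed.

(** Each label occurs with a single register value. [P] is trivial for the norm and selects the
    labels of an outcome for probabilities. *)
Lemma sqnorm_vector (P : pred L) z phi :
  (forall l, exists q, z l =1 pred1 q) ->
  \sum_k `|((P (label (enum_val k)))%:R * vector z phi k ord0)| ^+ 2 =
  (\sum_(l | P l) phi l ^+ 2)%:C.
Proof.
move=> z1; under eq_bigr => k _ do
  rewrite mxE normrM normr_nat normc_def /= expr0n addr0 sqrtr_sqr exprMn
    -[X in _ * X]rmorphXn /= real_normK ?num_real // -natrX.
rewrite (sum_index (fun q l => ((P l) ^ 2)%:R * (((z l q)%:R * phi l) ^+ 2)%:C)).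
rewrite [in RHS]big_mkcond rmorph_sum /=; apply: eq_bigr => l _.
have [q zq] := z1 l; rewrite (bigD1 q) //= zq /= eqxx mul1r big1.
  by case: (P l); rewrite ?addr0 ?mul1r ?mul0r.
by move=> q' /negPf qq'; rewrite zq /= qq' mul0r expr0n mulr0.
Qed.

Lemma slotP j l : exists q, (fun z => slot j l z == z0) =1 pred1 q.
Proof.
exists ((slot j l)^-1%g z0) => z /=.
by apply/eqP/eqP => [<-|->]; rewrite ?permK ?permKV.
Qed.

Let circuit_init := vector (fun l z => slot 0 l z == z0) phi0.

Lemma circuit_init_unit : \sum_k `|circuit_init k ord0| ^+ 2 = 1.
Proof.
transitivity ((\sum_l phi0 l ^+ 2)%:C); last by rewrite phi0_unit.
rewrite -(sqnorm_vector predT phi0 (slotP 0)).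
by apply: eq_bigr => k _; rewrite mul1r.
Qed.

Definition label_circuit : algorithm R n t :=
  @Algorithm R n t d circuit_init (fun j => circuit_unitary j) circuit_measure
    circuit_init_unit (fun j => circuit_unitaryP j) circuit_measureP.

Lemma run_label_circuit g j : (j <= t)%N ->
  run_upto label_circuit g j =
  vector (fun l z => slot j.+1 l z == z0) (label_state g j).
Proof.
elim: j => [|j IH] jt /=; first exact: circuit_unitary_vector.
by rewrite IH ?(ltnW jt) // oracle_op_vector inordK // circuit_unitary_vector.
Qed.

Lemma prob_label_circuit g y :
  prob_output label_circuit g y =
  (\sum_(l | out l == y) label_state g t l ^+ 2)%:C.
Proof.
rewrite -(sqnorm_vector (fun l => out l == y) (label_state g t) (slotP t.+1)).
apply: eq_bigr => k _; rewrite /final_state run_label_circuit //.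
by rewrite mul_diag_mx mxE [X in X * _]mxE.
Qed.

End LabelModel.

(** * Grover rotation, separating positions, binary encoding *)

Lemma sin_le_id (R : realType) (x : R) : 0 <= x -> sin x <= x.
Proof.
rewrite le_eqVlt => /predU1P[<-|x0]; first by rewrite sin0.
have [|c _] := @MVT R sin cos 0 x x0.
  exact/continuous_subspaceT/continuous_sin.
by rewrite sin0 !subr0 => ->; rewrite ler_piMl ?cos_le1 // ltW.
Qed.

(* Rotating by [2 theta] [floor (pi / (4 theta))] times ends within [theta]
   of [pi / 2]. *)
Lemma rotation_to_pihalf (R : realType) (theta : R) :
  0 < theta <= pi / 2 ->
  exists m : nat, m%:R <= theta^-1 /\
    cos theta ^+ 2 <= sin ((2 * m + 1)%:R * theta) ^+ 2.
Proof.
move=> /andP[th0 thpi]; have pi0 := pi_gt0 R.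
set q := pi / (4 * theta).
have q0 : 0 <= q by rewrite divr_ge0 ?mulr_ge0 ?ltW.
have /andP[lem ltm] := truncn_itv q0.
exists (Num.truncn q); set m := Num.truncn q in lem ltm *.
have qE : q * theta = pi / 4 by rewrite /q; field; rewrite gt_eqF.
split.
  apply: le_trans lem _; rewrite -(ler_pM2r th0) qE mulVf ?gt_eqF //.
  by have := pihalf_lt2 R; lra.
have m1 : m%:R * theta <= pi / 4 by rewrite -qE ler_pM2r.
have m2 : pi / 4 <= (m%:R + 1) * theta.
  by rewrite -qE ler_pM2r // natr1 ltW.
set x := (2 * m + 1)%:R * theta.
have xE : x = 2 * (m%:R * theta) + theta by rewrite /x natrD natrM; ring.
(* Measured from pi / 2, the claim becomes monotonicity of the cosine on [0, pi]. *)
have -> : sin x = cos `|x - pi / 2| by rewrite cos_norm cosBpihalf.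
have d_le : `|x - pi / 2| <= theta.
  by rewrite ler_norml xE; apply/andP; split; lra.
have cth : 0 <= cos theta by apply: cos_ge0_pihalf; lra.
rewrite lerXn2r ?nnegrE //.
  by apply: cos_ge0_pihalf; have := normr_ge0 (x - pi / 2); lra.
rewrite leNgt ltr_cos -?leNgt ?in_itv /= ?normr_ge0 //=; lra.
Qed.

(** Take [theta] with sine sqrt(K / N). Then sin theta <= theta bounds 1 / theta by sqrt(N / K), and
    cos^2 theta is (N - K) / N. *)
Lemma grover_rotation (R : realType) (N K : nat) : (0 < K <= N)%N ->
  exists (theta : R) (m : nat),
    [/\ sin theta = Num.sqrt (K%:R / N%:R),
        cos theta = Num.sqrt ((N - K)%:R / N%:R),
        m%:R <= Num.sqrt (N%:R / K%:R) :> R &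
        (N - K)%:R / N%:R <= sin ((2 * m + 1)%:R * theta) ^+ 2].
Proof.
move=> /andP[K0 KN]; have N0 := leq_trans K0 KN.
have NR : (0 : R) < N%:R by rewrite ltr0n.
set s := Num.sqrt (K%:R / N%:R : R).
have s0 : 0 < s by rewrite sqrtr_gt0 divr_gt0 ?ltr0n.
have s1 : s <= 1.
  by rewrite -sqrtr1 ler_sqrt ?ltr01 // ler_pdivrMr // mul1r ler_nat.
have sI : -1 <= s <= 1 by lra.
have sE : sin (asin s) = s by rewrite asinK.
have s2 : s ^+ 2 = K%:R / N%:R by rewrite sqr_sqrtr ?divr_ge0.
have cE : cos (asin s) = Num.sqrt ((N - K)%:R / N%:R).
  rewrite cos_asin // s2 natrB //; congr Num.sqrt; field; exact: lt0r_neq0.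
have th_le := asin_lepi2 sI.
have th0 : 0 < asin s.
  rewrite ltNge; apply/negP => th.
  suff : sin (asin s) <= 0 by rewrite sE leNgt s0.
  rewrite -[asin s]opprK sinN oppr_le0 sin_ge0_pi //.
  by have := asin_geNpi2 sI; have := pi_gt0 R; lra.
have [|m [mle msin]] := @rotation_to_pihalf R (asin s); first by rewrite th0.
exists (asin s), m; split => //.
  apply: le_trans mle _; rewrite -[Num.sqrt _]invrK lef_pV2 ?posrE //.
    rewrite -sqrtrV ?divr_ge0 // invf_div -/s -[leLHS]sE.
    exact/sin_le_id/ltW.
  by rewrite invr_gt0 sqrtr_gt0 divr_gt0 ?ltr0n.
by apply: le_trans msin; rewrite cE sqr_sqrtr ?divr_ge0.
Qed.

(** Set one element [a] aside and separate the others. At most one [b] among them agrees with [a] on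
    the chosen points, and one further point tells [a] and [b] apart. *)
Lemma separating_seq (X : eqType) (I : finType) (f : I -> X -> bool) (x0 : X) :
  (forall i j, f i =1 f j -> i = j) -> forall (k : nat) (A : {set I}), (#|A| <= k.+1)%N ->
  exists2 p : seq X, size p = k &
    {in A &, forall i j, (forall x, x \in p -> f i x = f j x) -> i = j}.
Proof.
move=> inj; elim=> [|k IH] A leA.
  exists [::] => // i j iA jA _; apply/eqP.
  by move: leA => /card_le1_eqP /(_ _ _ iA jA) ->.
have [->|[a aA]] := set_0Vmem A.
  by exists (nseq k.+1 x0); rewrite ?size_nseq // => i j; rewrite inE.
have [|p sp sep] := IH (A :\ a).
  by move: leA; rewrite (cardsD1 a) aA.
have [[b bA ab]|nob] :=
  pselect (exists2 b, b \in A :\ a & forall x, x \in p -> f b x = f a x).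
  have [y fab] : exists y, f b y != f a y.
    apply: contrapT => /forallNP fE; move: bA; rewrite !inE => /andP[/eqP + _]; apply.
    by apply: inj => y; apply/eqP/negPn/negP/fE.
  have uniq_b c : c \in A :\ a -> (forall x, x \in p -> f c x = f a x) -> c = b.
    by move=> cA ca; apply: sep => // x xp; rewrite ca ?ab.
  exists (y :: p); first by rewrite /= sp.
  move=> i j iA jA ij.
  have ijp x : x \in p -> f i x = f j x by move=> xp; apply: ij; rewrite inE xp orbT.
  have fy : f i y = f j y by apply: ij; rewrite inE eqxx.
  have [ia|ia] := eqVneq i a; have [ja|ja] := eqVneq j a; rewrite ?ia ?ja //.
  - have jb : j = b by apply: uniq_b => [|x xp]; rewrite ?inE ?ja ?ijp -?ia ?ijp.
    by move: fab; rewrite -jb -fy ia eqxx.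
  - have ib : i = b by apply: uniq_b => [|x xp]; rewrite ?inE ?ia ?iA -?ja ?ijp.
    by move: fab; rewrite -ib fy ja eqxx.
  - by apply: sep; rewrite ?inE ?ia ?ja.
(* No other element agrees with [a] on [p], so [x0] only pads to the prescribed length. *)
exists (x0 :: p); first by rewrite /= sp.
move=> i j iA jA ij.
have ijp x : x \in p -> f i x = f j x by move=> xp; apply: ij; rewrite inE xp orbT.
have [ia|ia] := eqVneq i a; have [ja|ja] := eqVneq j a; rewrite ?ia ?ja //.
- by case: nob; exists j => [|x xp]; rewrite ?inE ?ja // -ijp // ia.
- by case: nob; exists i => [|x xp]; rewrite ?inE ?ia // ijp // ja.
- by apply: sep; rewrite ?inE ?ia ?ja.
Qed.

Lemma odd_digits_inj n j k : (j < 2 ^ n)%N -> (k < 2 ^ n)%N ->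
  (forall i, (i < n)%N -> odd (j %/ 2 ^ i) = odd (k %/ 2 ^ i)) -> j = k.
Proof.
elim: n j k => [|n IH] j k; first by rewrite expn0; case: j k => [|?] [|?].
rewrite expnS => jn kn e.
have e0 : odd j = odd k by have := e 0%N isT; rewrite expn0 !divn1.
suff e2 : (j %/ 2 = k %/ 2)%N.
  by rewrite -(odd_double_half j) -(odd_double_half k) -!divn2 e0 e2.
apply: IH => [||i lt_in]; try by rewrite ltn_divLR // mulnC.
by rewrite -!divnMA -!expnS e.
Qed.

Lemma binary_inj n : injective (fun j : 'I_(2 ^ n) => binary n j).
Proof.
move=> j k /(congr1 (fun s : bits n => tnth s)) e; apply: val_inj.
apply: (@odd_digits_inj n) => [||i lt_in]; [exact: ltn_ord|exact: ltn_ord|].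
(* The bit of weight 2^i sits at position [n.-1 - i], the most significant bit coming first. *)
have lt' : (n.-1 - i < n)%N by case: n lt_in {j k e} => // n; lia.
move: (congr1 (fun h => h (Ordinal lt')) e); rewrite !tnth_mktuple /=.
suff -> : (n.-1 - (n.-1 - i) = i)%N by [].
by case: n lt_in {j k e lt'} => // n; lia.
Qed.

Lemma binary_bij n : bijective (fun j : 'I_(2 ^ n) => binary n j).
Proof.
by apply: inj_card_bij (@binary_inj n) _; rewrite card_tuple card_bool card_ord.
Qed.

Lemma oracle_matrix_B n K (f : 'I_(2 ^ n) -> oracle n) :
  oracle_matrix f \in B (2 ^ n) K ->
  (forall i, #|[set x | f i x]| = K) /\ (forall x, #|[set i | f i x]| = K).
Proof.
have [h hK Kh] := binary_bij n.
rewrite inE => /andP[/forallP row /forallP col]; split => [i|x].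
  rewrite -(eqP (row i)) -(card_imset _ (@binary_inj n)); apply: eq_card => x.
  rewrite inE; apply/idP/imsetP => [fx|[j + ->]]; last by rewrite !inE mxE.
  by exists (h x); rewrite ?inE ?mxE Kh.
by rewrite -(eqP (col (h x))); apply: eq_card => i; rewrite !inE mxE Kh.
Qed.

(** * Diffusion and Walsh kernels, Grover search *)

Section Kernels.
Variable R : realType.

Definition id_kernel (I : eqType) (a b : I) : R := (a == b)%:R.

Definition tensor (I J : finType) (A : I -> I -> R) (B : J -> J -> R)
  (l l' : I * J) : R := A l.1 l'.1 * B l.2 l'.2.

(** Grover's reflection 2 |s><s| - 1 about the uniform superposition s. *)
Definition diffusion (I : finType) (a b : I) : R :=
  2%:R / #|I|%:R - (a == b)%:R.

Definition hadamard (a b : bool) : R := (Num.sqrt 2%:R)^-1 * (-1) ^+ (a && b).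

Definition walsh (I : finType) (u v : {ffun I -> bool}) : R :=
  \prod_i hadamard (u i) (v i).

Lemma sum_id_kernel (I : finType) (a : I) (F : I -> R) :
  \sum_b id_kernel a b * F b = F a.
Proof. by rewrite -[RHS]sum_indicator; apply: eq_bigr => b _; rewrite eq_sym. Qed.

Lemma id_kernel_orthogonal (I : finType) : orthogonal_kernel (@id_kernel I).
Proof. by move=> a b; rewrite sum_id_kernel /id_kernel eq_sym. Qed.

Lemma tensor_orthogonal (I J : finType) (A : I -> I -> R) (B : J -> J -> R) :
  orthogonal_kernel A -> orthogonal_kernel B -> orthogonal_kernel (tensor A B).
Proof.
move=> oA oB [a a'] [b b']; rewrite /tensor /=.
rewrite -(pair_bigA _ (fun x y => A a x * B a' y * (A b x * B b' y))) /=.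
transitivity (\sum_x A a x * A b x * \sum_y B a' y * B b' y).
  by apply: eq_bigr => x _; rewrite mulr_sumr; apply: eq_bigr => y _; ring.
by rewrite -mulr_suml oA oB -natrM mulnb xpair_eqE.
Qed.

Lemma tensor_id_r (I J : finType) (A : I -> I -> R) (F : I * J -> R) l :
  \sum_l' tensor A (@id_kernel J) l l' * F l' = \sum_x A l.1 x * F (x, l.2).
Proof.
pose G x y := A l.1 x * id_kernel l.2 y * F (x, y).
rewrite (eq_bigr (fun l' => G l'.1 l'.2)) => [|[x y] _ //].
rewrite -(pair_bigA _ G) /=.
apply: eq_bigr => x _; rewrite -(sum_id_kernel l.2 (fun y => A l.1 x * F (x, y))).
by apply: eq_bigr => y _; rewrite /G; ring.
Qed.

Lemma tensor_id_l (I J : finType) (B : J -> J -> R) (F : I * J -> R) l :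
  \sum_l' tensor (@id_kernel I) B l l' * F l' = \sum_y B l.2 y * F (l.1, y).
Proof.
rewrite -(sum_id_kernel l.1 (fun x => \sum_y B l.2 y * F (x, y))).
pose G x y := id_kernel l.1 x * B l.2 y * F (x, y).
rewrite (eq_bigr (fun l' => G l'.1 l'.2)) => [|[x y] _ //].
rewrite -(pair_bigA _ G) /=; apply: eq_bigr => x _.
by rewrite mulr_sumr; apply: eq_bigr => y _; rewrite /G mulrA.
Qed.

Lemma sum_diffusion (I : finType) (a : I) (F : I -> R) :
  \sum_b diffusion a b * F b = 2%:R / #|I|%:R * (\sum_b F b) - F a.
Proof.
rewrite -(sum_id_kernel a F) mulr_sumr -sumrB.
by apply: eq_bigr => b _; rewrite mulrBl.
Qed.

Lemma diffusion_orthogonal (I : finType) : orthogonal_kernel (@diffusion I).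
Proof.
move=> a b; rewrite sum_diffusion /diffusion.
have I0 : #|I|%:R != 0 :> R by rewrite pnatr_eq0 -lt0n; apply/card_gt0P; exists a.
rewrite sumrB sumr_const -[X in X - \sum__ _]mulr_natr.
have -> : \sum_i (b == i)%:R = 1 :> R.
  by rewrite -[RHS](sum_id_kernel b (fun=> 1)); apply: eq_bigr => i _; rewrite mulr1.
by rewrite (eq_sym b); field.
Qed.

Lemma hadamardC a b : hadamard a b = hadamard b a.
Proof. by rewrite /hadamard andbC. Qed.

Lemma hadamard_orthogonal : orthogonal_kernel hadamard.
Proof.
have s2 : (Num.sqrt 2%:R)^-1 * (Num.sqrt 2%:R)^-1 = 2%:R^-1 :> R.
  by rewrite -invfM -expr2 sqr_sqrtr ?ler0n.
move=> a b; rewrite big_bool /hadamard.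
transitivity (((Num.sqrt 2%:R)^-1 * (Num.sqrt 2%:R)^-1) *
  ((-1) ^+ (a && true) * (-1) ^+ (b && true) + 1) : R).
  by rewrite !andbF /= !expr0; ring.
by rewrite s2; case: a; case: b => /=; field.
Qed.

Lemma walshC (I : finType) (u v : {ffun I -> bool}) : walsh u v = walsh v u.
Proof. by apply: eq_bigr => i _; rewrite hadamardC. Qed.

(** The sum over all functions of a product is a product of coordinatewise sums, and one differing
    coordinate makes it vanish. *)
Lemma walsh_orthogonal (I : finType) : orthogonal_kernel (@walsh I).
Proof.
move=> u v; under eq_bigr => w _ do rewrite -big_split /=.
rewrite -(bigA_distr_bigA (fun i b => hadamard (u i) b * hadamard (v i) b)) /=.
under eq_bigr => i _ do rewrite hadamard_orthogonal.
rewrite -natr_prod; congr (_%:R).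
have [->|] := eqVneq; first by rewrite big1 // => i _; rewrite eqxx.
move=> uv; have [i ui] : exists i, u i != v i.
  apply/existsP; apply: contraNT uv; rewrite negb_exists => /forallP e.
  by apply/eqP/ffunP => i; apply/eqP; have := e i; rewrite negbK.
by rewrite (bigD1 i) //= (negPf ui).
Qed.

(** Only the Hadamard factor at [k] changes, by a sign: a phase query controlled by [u k] writes its
    answer into coordinate [k] of the Walsh index. *)
Lemma walsh_flip (I : finType) (u v v' : {ffun I -> bool}) k :
  v k = false -> (forall i, i != k -> v' i = v i) ->
  walsh u v' = (-1) ^+ (u k && v' k) * walsh u v.
Proof.
move=> vk vv'; rewrite /walsh !(bigD1 k (P := predT)) //=.
rewrite (eq_bigr (fun i => hadamard (u i) (v i))) => [|i /vv' -> //].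
by rewrite /hadamard vk andbF /= expr0; ring.
Qed.

End Kernels.

Section Grover.
Variables (R : realType) (n : nat) (g : oracle n).

Fixpoint grover_amplitude (j : nat) : bits n -> R :=
  if j is j'.+1 then fun x => \sum_y diffusion R x y *
    ((-1) ^+ g y * grover_amplitude j' y)
  else fun=> (Num.sqrt (2 ^ n)%:R)^-1.

Variables (K : nat) (theta : R).
Hypothesis gK : #|[set x | g x]| = K.
Hypothesis K_bounds : (0 < K < 2 ^ n)%N.
Hypothesis sin_theta : sin theta = Num.sqrt (K%:R / (2 ^ n)%N%:R).
Hypothesis cos_theta : cos theta = Num.sqrt ((2 ^ n - K)%N%:R / (2 ^ n)%N%:R).

(** The state stays in the plane spanned by the uniform superpositions over ones and zeros of [g],
    where each iteration rotates by 2 theta. *)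
Lemma grover_amplitudeE j x : grover_amplitude j x =
  if g x then sin ((2 * j + 1)%:R * theta) / Num.sqrt K%:R
  else cos ((2 * j + 1)%:R * theta) / Num.sqrt (2 ^ n - K)%:R.
Proof.
have /andP[K0 KN] := K_bounds.
pose a : R := Num.sqrt K%:R; pose b : R := Num.sqrt (2 ^ n - K)%:R.
pose c : R := Num.sqrt (2 ^ n)%:R; rewrite -/a -/b.
have a0 : a != 0 by rewrite gt_eqF // sqrtr_gt0 ltr0n.
have b0 : b != 0 by rewrite gt_eqF // sqrtr_gt0 ltr0n subn_gt0.
have c0 : c != 0 by rewrite gt_eqF // sqrtr_gt0 ltr0n expn_gt0.
have a2 : a ^+ 2 = K%:R by rewrite sqr_sqrtr.
have b2 : b ^+ 2 = (2 ^ n - K)%:R by rewrite sqr_sqrtr.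
have c2 : c ^+ 2 = (2 ^ n)%:R by rewrite sqr_sqrtr.
have abc : a ^+ 2 + b ^+ 2 = c ^+ 2 by rewrite a2 b2 c2 -natrD subnKC // ltnW.
have sE : sin theta = a / c by rewrite sin_theta sqrtrM // sqrtrV.
have cE : cos theta = b / c by rewrite cos_theta sqrtrM // sqrtrV.
have init y : grover_amplitude 0 y = c^-1 by [].
clearbody a b c; elim: j x => [|j IH] x.
  by rewrite muln0 add0n mul1r sE cE init; case: (g x); field; apply/andP.
rewrite /= sum_diffusion card_tuple card_bool -c2.
set phi := (2 * j + 1)%:R * theta in IH *.
rewrite (_ : (2 * j.+1 + 1)%:R * theta = phi + (theta + theta)); last first.
  by rewrite /phi mulnS !natrD; ring.
have -> : \sum_y (-1) ^+ g y * grover_amplitude j y = b * cos phi - a * sin phi.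
  rewrite (bigID (fun y => g y)) /=.
  rewrite (eq_bigr (fun=> - (sin phi / a))) => [|y gy]; last by rewrite IH gy mulN1r.
  rewrite [X in _ + X](eq_bigr (fun=> cos phi / b)) => [|y /negPf gy]; last first.
    by rewrite IH gy mul1r.
  rewrite !sumr_const -cardsE gK.
  have -> : #|[pred y | ~~ g y]| = (2 ^ n - K)%N.
    have := cardC [set y | g y]; rewrite card_tuple card_bool gK => <-.
    by rewrite addKn; apply: eq_card => y; rewrite !inE.
  by rewrite -[X in X + _]mulr_natr -[X in _ + X]mulr_natr -a2 -b2; field; apply/andP.
have one : 1 = (a ^+ 2 + b ^+ 2) / c ^+ 2 by rewrite abc divff // expf_neq0.
have sin2 : sin (theta + theta) = 2%:R * a * b / c ^+ 2.
  by rewrite sinD sE cE; field.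
(* Two forms of cos(2 theta): the one in [a] matches the ones of [g], the one in [b] the zeros, so
   that no use of a^2 + b^2 = c^2 remains. *)
have cos2a : cos (theta + theta) = 1 - 2%:R * a ^+ 2 / c ^+ 2.
  by rewrite cosD sE cE [X in _ = X - _]one; field.
have cos2b : cos (theta + theta) = 2%:R * b ^+ 2 / c ^+ 2 - 1.
  by rewrite cosD sE cE [X in _ = _ - X]one; field.
rewrite IH (sinD phi) (cosD phi) sin2; case: (g x); [rewrite cos2a|rewrite cos2b];
  by field; apply/andP.
Qed.

Lemma grover_success j :
  \sum_(x | g x) grover_amplitude j x ^+ 2 = sin ((2 * j + 1)%:R * theta) ^+ 2.
Proof.
have /andP[K0 KN] := K_bounds.
under eq_bigr => x gx do rewrite grover_amplitudeE gx.
rewrite sumr_const -cardsE gK -[LHS]mulr_natr exprMn exprVn sqr_sqrtr //.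
by field; rewrite pnatr_eq0 -lt0n.
Qed.

End Grover.

(** * Search followed by probing *)

Section GroverThenProbe.
Local Open Scope complex_scope.
Variables (R : realType) (n m T : nat) (probe : bits n -> 'I_T -> bits n).
Hypothesis T0 : (0 < T)%N.

(* A label [(x, u)] holds the Grover register [x] and the selectors [u] of the
   [T] probes; probe [k] is asked in superposition over [u k], so that the
   answers are recovered by the Walsh transform of the phases. *)
Local Notation labels := (bits n * {ffun 'I_T -> bool})%type.

(** Kernel [j] follows query [j - 1]: diffusions 1 to [m] close Grover queries 0 to [m - 1], and the
    Walsh transform comes right after the last probe. *)
Definition identify_kernel (j : nat) : labels -> labels -> R :=
  tensor (if (0 < j <= m)%N then @diffusion R _ else @id_kernel R _)
         (if j == (m + T)%N then @walsh R _ else @id_kernel R _).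

(** The default branch covers the registers loaded after the final query; its control bit false
    makes the phase trivial. *)
Definition identify_query (j : nat) (l : labels) : bits n * bool :=
  if (j < m)%N then (l.1, true)
  else if insub (j - m)%N is Some k then (probe l.1 k, l.2 k) else (l.1, false).

(** Uniform in both registers, since [walsh] at the zero function is constant; this form is the
    Walsh vector of no answers yet. *)
Definition identify_init (l : labels) : R :=
  (Num.sqrt (2 ^ n)%:R)^-1 * walsh R l.2 [ffun=> false].

Lemma identify_kernel_orthogonal j : orthogonal_kernel (identify_kernel j).
Proof.
apply: tensor_orthogonal; case: ifP => _.
- exact: diffusion_orthogonal.
- exact: id_kernel_orthogonal.
- exact: walsh_orthogonal.
- exact: id_kernel_orthogonal.
Qed.

Lemma identify_init_unit : \sum_l identify_init l ^+ 2 = 1.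
Proof.
pose F (x : bits n) (u : {ffun 'I_T -> bool}) : R :=
  ((Num.sqrt (2 ^ n)%:R)^-1 * walsh R u [ffun=> false]) ^+ 2.
rewrite -(pair_bigA _ F) /F /= sumr_const card_tuple card_bool.
under eq_bigr => u _ do rewrite exprMn expr2 [X in _ * X]expr2 walshC.
rewrite -mulr_sumr walsh_orthogonal eqxx mulr1 -expr2 exprVn sqr_sqrtr //.
by rewrite -[LHS]mulr_natr mulVf // pnatr_eq0 -lt0n expn_gt0.
Qed.

Local Notation state g := (label_state identify_query identify_kernel
  identify_init g).

(** Probes not yet asked count as false, as [walsh_flip] requires of the coordinate about to be
    written. *)
Definition answers (g : oracle n) (k : nat) (x : bits n) : {ffun 'I_T -> bool} :=
  [ffun i : 'I_T => (i < k)%N && g (probe x i)].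

Lemma answers0 g x : answers g 0 x = [ffun=> false].
Proof. by apply/ffunP => i; rewrite !ffunE. Qed.

Lemma state_search g j l : (j <= m)%N ->
  state g j l = grover_amplitude R g j l.1 * walsh R l.2 [ffun=> false].
Proof.
elim: j l => [|j IH] l jm /=; rewrite /identify_kernel.
  by rewrite ltnn (_ : (0 == m + T)%N = false) ?tensor_id_r ?sum_id_kernel //; lia.
rewrite jm (_ : (_ == _) = false); last by lia.
rewrite tensor_id_r mulr_suml; apply: eq_bigr => x _.
by rewrite IH ?(ltnW jm) // /query_phase /identify_query jm /= !mulrA.
Qed.

Lemma phase_probe g (k : 'I_T) l :
  (-1) ^+ query_phase g (identify_query (m + k) l) *
    walsh R l.2 (answers g k l.1) = walsh R l.2 (answers g k.+1 l.1).
Proof.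
rewrite /query_phase /identify_query ltnNge leq_addr /= addKn valK /=.
rewrite (@walsh_flip _ _ _ (answers g k l.1) (answers g k.+1 l.1) k).
- by rewrite [in RHS]ffunE ltnSn.
- by rewrite ffunE ltnn.
- by move=> i ik; rewrite !ffunE ltnS leq_eqVlt (negPf (ik : (i != k :> nat))).
Qed.

Lemma state_probe g k l : (k < T)%N ->
  state g (m + k) l = grover_amplitude R g m l.1 * walsh R l.2 (answers g k l.1).
Proof.
elim: k l => [|k IH] l kT; first by rewrite addn0 state_search ?answers0.
rewrite addnS /= /identify_kernel ifF; last by lia.
rewrite ifF; last by lia.
rewrite tensor_id_r sum_id_kernel IH ?(ltnW kT) //= mulrCA.
by rewrite (phase_probe g (Ordinal (ltnW kT)) (l.1, l.2)).
Qed.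

(** The last probe completes the Walsh vector of all answers; the Walsh transform, symmetric and
    orthogonal, turns it into a basis vector. *)
Lemma state_final g l :
  state g (m + T) l = grover_amplitude R g m l.1 * (l.2 == answers g T l.1)%:R.
Proof.
have E : (m + T = (m + T.-1).+1)%N by lia.
have lt : (T.-1 < T)%N by rewrite prednK.
rewrite E /= /identify_kernel ifF; last by lia.
rewrite -E eqxx tensor_id_l.
rewrite -[in RHS](walsh_orthogonal R) mulr_sumr; apply: eq_bigr => u _.
have := phase_probe g (Ordinal lt) (l.1, u); rewrite /= prednK // => ph.
by rewrite state_probe //= (walshC _ (answers g T l.1)) -ph; ring.
Qed.

Definition identify_circuit (out : labels -> 'I_(2 ^ n)) : algorithm R n (m + T) :=
  label_circuit (m + T) identify_query out identify_kernel_orthogonal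
    identify_init_unit.

(** Only labels at a one of [g] with the true answers are counted; all others contribute
    nonnegatively. *)
Lemma prob_identify_circuit out (g : oracle n) y :
  (forall x, g x -> out (x, answers g T x) = y) ->
  (\sum_(x | g x) grover_amplitude R g m x ^+ 2)%:C <=
  prob_output (identify_circuit out) g y.
Proof.
move=> outE; rewrite prob_label_circuit lecR.
pose F x u := if out (x, u) == y then
  (grover_amplitude R g m x * (u == answers g T x)%:R) ^+ 2 else 0.
rewrite [leRHS]big_mkcond /= (eq_bigr (fun l => F l.1 l.2)); last first.
  by move=> [x u] _; rewrite state_final.
rewrite -(pair_bigA _ F) big_mkcond /=; apply: ler_sum => x _.
rewrite (bigD1 (answers g T x)) //= /F eqxx mulr1.
have r0 : 0 <= \sum_(u | u != answers g T x) F x u.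
  by apply: sumr_ge0 => u _; rewrite /F; case: ifP; rewrite ?sqr_ge0.
have [gx|_] := boolP (g x); first by rewrite outE // eqxx lerDl.
by rewrite addr_ge0 //; case: ifP; rewrite ?sqr_ge0.
Qed.

End GroverThenProbe.

Lemma row_col_weights_solvable (R : realType) n K (f : 'I_(2 ^ n) -> oracle n) :
  (0 < K)%N -> (3 * K <= 2 ^ n)%N -> injective f ->
  (forall i, #|[set x | f i x]| = K) -> (forall x, #|[set i | f i x]| = K) ->
  exists m : nat, m%:R <= Num.sqrt ((2 ^ n)%:R / K%:R) :> R /\
    solvable_with R f (m + K).
Proof.
move=> K0 K3 inj rowK colK; have N0 : (0 < 2 ^ n)%N by rewrite expn_gt0.
have [|theta [m [sE cE mle succ]]] := @grover_rotation R (2 ^ n) K.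
  by rewrite K0; lia.
have inj' i j : f i =1 f j -> i = j by move=> /ffunP/inj.
have x0 : bits n := [tuple false | _ < n].
have sep x : exists p : {ffun 'I_K -> bits n},
    forall i j, f i x -> f j x -> (forall k, f i (p k) = f j (p k)) -> i = j.
  (* [K - 1] points already separate [K] candidates; taking [K] keeps the number of probes positive
     when [K = 1]. *)
  have [|p sp pP] := @separating_seq _ _ f x0 inj' K [set i | f i x].
    by rewrite colK.
  exists [ffun k : 'I_K => nth x0 p k] => i j ix jx e.
  apply: pP; rewrite ?inE // => y /(nthP x0)[k kp <-]; rewrite sp in kp.
  by have := e (Ordinal kp); rewrite ffunE.
have [probe probeP] := choice sep.
(* Decoding picks an index with value one at [x] and the recorded answers; index 0 is the default
   for inconsistent labels. *)
pose out (l : bits n * {ffun 'I_K -> bool}) : 'I_(2 ^ n) :=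
  odflt (Ordinal N0) [pick i | f i l.1 & [forall k, f i (probe l.1 k) == l.2 k]].
exists m; split => //; exists (identify_circuit R m (fun x => probe x) out) => i.
apply: le_trans (@prob_identify_circuit R n m K _ K0 out (f i) i _); last first.
  move=> x fx; rewrite /out /=; case: pickP => [j /andP[jx /forallP jP]|/(_ i)].
    by apply: (probeP x) => // k; have /eqP-> := jP k; rewrite ffunE ltn_ord.
  rewrite fx /= => /negP[]; apply/forallP => k.
  by rewrite ffunE ltn_ord.
rewrite (grover_success (rowK i) _ sE cE) ?K0 /=; last by lia.
have -> : 2%:R / 3%:R = ((2%:R / 3%:R : R)%:C)%C.
  by rewrite rmorphM fmorphV !rmorph_nat.
(* Here 3K <= N makes (N - K) / N at least 2/3. *)
rewrite lecR; apply: le_trans succ.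
rewrite ler_pdivrMr ?ltr0n // mulrAC ler_pdivlMr ?ltr0n //.
by rewrite -!natrM ler_nat; lia.
Qed.

(** * Query complexity and the two bounds *)

Lemma QP (R : realType) n (f : 'I_(2 ^ n) -> oracle n) t :
  solvable_with R f t -> solvable_with R f (Q R f) /\ (Q R f <= t)%N.
Proof.
move=> sol; have ex : exists t, `[< solvable_with R f t >] by exists t; apply/asboolP.
have [min /asboolP solmin minP] := ex_minnP ex.
rewrite /Q; case: xgetP => [y _ [ysol ymin]|none]; first by split; last exact: ymin.
(* The default of [xget] is excluded, since [min] satisfies the predicate. *)
by case: (none min); split => // t' /asboolP/minP.
Qed.

Theorem theorem6 (R : realType) :
  exists (c C : R) (N0 : nat), 0 < c /\ 0 < C /\
    forall (n K : nat) (f : 'I_(2 ^ n) -> oracle n),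
      (N0 <= 2 ^ n)%N ->
      (0 < K)%N ->
      K%:R <= ((2 ^ n)%N%:R : R) `^ (3%:R^-1) ->
      injective f ->
      oracle_matrix f \in B (2 ^ n) K ->
      c * Num.sqrt ((2 ^ n)%N%:R / K%:R) <= (Q R f)%:R /\
      (Q R f)%:R <= C * Num.sqrt ((2 ^ n)%N%:R / K%:R).
Proof.
(* C = 2 because search and probes cost at most sqrt(N / K) each. N >= 6 absorbs the additive 3 of
   the lower bound into N <= 24 K Q^2, and 24 <= 25 gives c = 1/5. *)
exists 5%:R^-1, 2%:R, 6%N; split; first by rewrite invr_gt0.
split=> // n K f N6 K0 K_le inj /oracle_matrix_B[rowK colK].
have K3 : (K ^ 3 <= 2 ^ n)%N.
  rewrite -(ler_nat R) natrX; apply: le_trans (lerXn2r 3 _ _ K_le) _;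
    rewrite ?nnegrE ?powR_ge0 //.
  by rewrite -powR_mulrn ?powR_ge0 // -powRrM mulVf ?pnatr_eq0 // powRr1.
have [m [m_le msol]] : exists m : nat, m%:R <= Num.sqrt ((2 ^ n)%:R / K%:R) :> R /\
    solvable_with R f (m + K).
  (* For K >= 2, 3K <= K^3 <= N; for K = 1, N >= 6 suffices. *)
  by apply: row_col_weights_solvable => //; move: K3 N6; rewrite !expnS expn0; nia.
have [[A solA] Q_le] := QP msol.
have K_sqrt : K%:R <= Num.sqrt ((2 ^ n)%:R / K%:R) :> R.
  rewrite -[leLHS]ger0_norm // -sqrtr_sqr ler_wsqrtr // ler_pdivlMr ?ltr0n //.
  by rewrite -exprSr -natrX ler_nat.
split.
  have N_le : (2 ^ n <= 24 * K * Q R f ^ 2)%N.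
    have colK' x : (#|[set i | f i x]| <= K)%N by rewrite colK.
    by have := solves_OIP_lower colK' solA; lia.
  rewrite mulrC ler_pdivrMr // -[leRHS]ger0_norm ?mulr_ge0 // -sqrtr_sqr.
  rewrite ler_wsqrtr // ler_pdivrMr ?ltr0n // -natrM -natrX -natrM ler_nat.
  by apply: leq_trans N_le _; rewrite expnMn; lia.
apply: le_trans (_ : (m + K)%:R <= _); first by rewrite ler_nat.
by rewrite natrD mulr_natl mulr2n lerD.
Qed.
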